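(* Let $R=[R_{mn}]\in\mathbb{R}^{N\times N}$ ($N\ge2$) be the stochastic matrix of a discrete-time Markov chain satisfying the assumptions of the context, with steady state $\pi$, let $K\ge1$ be the number of time steps in the duration $\tau$, and let $a,b\in\mathbb{R}^N$ be observables with $\|a\|_*\|b\|_*\ne0$. Then $$\frac{|\delta C_{ba}^\tau|}{\|a\|_*\|b\|_*}\le K e^{-(K-1)g}\,\frac{\sigma}{\Phi\!\left(\frac{\sigma}{2\gamma}\right)}.$$
   Context: Setting. The chain is time-homogeneous and irreducible: $p_{t_i}=Rp_{t_{i-1}}$, where $R_{mn}\ge0$ is the transition probability from state $n$ to state $m$, $\sum_mR_{mn}=1$ for all $n$. For $m\ne n$, $R_{mn}>0$ if and only if $R_{nm}>0$ (so that $\sigma$ below is finite). Times are $t_0=0,\dots,t_K=\tau$. $\pi$ is the steady state, a probability vector with $R\pi=\pi$; $\Pi:=\mathrm{diag}(\pi_1,\dots,\pi_N)$. Spectral assumptions. The eigenvalues of $R$ satisfy $1=\lambda_1>|\lambda_2|\ge|\lambda_3|\ge\dots$. There are left eigenvectors $v_n^l\in\mathbb{C}^N$, $(v_n^l)^\dagger R=\lambda_n(v_n^l)^\dagger$, normalized by $(v_n^l)^\dagger v_n^l=1$, with $v_1^l$ proportional to the all-one vector, forming a basis of $\mathbb{C}^N$ (fixed). Spectral gap $g:=-\ln|\lambda_2|>0$ (with $\lambda_2\neq0$). For $z=\sum_n\tilde z_nv_n^l$, set $\|z\|_*:=\sum_{n\ge2}|\tilde z_n|$. Correlations. $C_{ba}^\tau:=\langle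 b(\tau)a(0)\rangle=b^\top R^K\Pi a$ and $\delta C_{ba}^\tau:=C_{ba}^\tau-C_{ab}^\tau$. Per-step entropy production and dynamical activity: $\sigma:=\sum_{m\neq n}R_{mn}\pi_n\ln\frac{R_{mn}\pi_n}{R_{nm}\pi_m}$, $\gamma:=\sum_{m\neq n}R_{mn}\pi_n$ (pairs with zero transition probabilities contribute $0$). $\Phi:[0,\infty)\to[0,\infty)$ is the inverse function of $u\mapsto u\tanh u$ on $[0,\infty)$. When $\sigma=0$ the expression $\sigma/\Phi(\sigma/2\gamma)$ is understood as its limit $0$. *)

(* Defs.v *)
From HB Require Import structures.
From mathcomp Require Import all_boot all_order all_algebra.
From mathcomp Require Import complex.
From mathcomp Require Import boolp classical_sets functions set_interval reals.
From mathcomp Require Import sequences exp.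

Set Implicit Arguments.
Unset Strict Implicit.
Unset Printing Implicit Defensive.

Import Order.TTheory GRing.Theory Num.Theory.
Local Open Scope ring_scope.

(* Matrices act on column vectors: R m n is the probability of the transition
   n -> m, so that the columns of a stochastic matrix sum to 1. *)

Definition stochastic (F : realType) (N : nat) (R : 'M[F]_N) : Prop :=
  (forall m n, 0 <= R m n) /\ (forall n, \sum_m R m n = 1).

Definition irreducible_chain (F : realType) (N : nat) (R : 'M[F]_N) : Prop :=
  forall m n, exists k : nat, 0 < (R ^+ k) m n.

Definition probability_vector (F : realType) (N : nat) (p : 'cV[F]_N) : Prop :=
  (forall n, 0 <= p n 0) /\ \sum_n p n 0 = 1.

Definition steady_state (F : realType) (N : nat) (R : 'M[F]_N)
    (p : 'cV[F]_N) : Prop :=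
  probability_vector p /\ R *m p = p.

(* The modulus `|z| lives in F[i]; Normc.normc z is the same modulus in F. *)
Notation cmod := Normc.normc.

Definition to_complex (F : realType) (m n : nat) (A : 'M[F]_(m, n)) :
    'M[F[i]]_(m, n) :=
  map_mx (real_complex F) A.

Section LeftEigenvectors.
Local Open Scope sesquilinear_scope.

Definition left_eigenvector (F : realType) (N : nat) (R : 'M[F]_N)
    (lam : F[i]) (v : 'cV[F[i]]_N) : Prop :=
  v ^t* *m to_complex R = lam *: v ^t*.

Definition unit_vector (F : realType) (N : nat) (v : 'cV[F[i]]_N) : Prop :=
  v ^t* *m v = 1%:M.

End LeftEigenvectors.

(* Since the v_n form a basis, the lambda_n are all the eigenvalues of R,
   listed with multiplicity.  Indices start at 0: the index 0 plays the role of
   n = 1. *)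
Definition left_eigenbasis (F : realType) (N : nat) (R : 'M[F]_N)
    (lambda : 'I_N -> F[i]) (v : 'I_N -> 'cV[F[i]]_N) : Prop :=
  [/\ basis_of {: 'cV[F[i]]_N} (mktuple v),
      forall n, left_eigenvector R (lambda n) (v n),
      forall n, unit_vector (v n)
    & forall n : 'I_N, n = 0%N :> nat -> exists c, v n = c *: const_mx 1].

Definition spectral_gap (F : realType) (lambda2 : F[i]) : F :=
  - ln (cmod lambda2).

Definition star_norm (F : realType) (N : nat) (v : 'I_N -> 'cV[F[i]]_N)
    (z : 'cV[F[i]]_N) : F :=
  \sum_(n < N | (0 < n)%N) cmod (coord (mktuple v) n z).

Definition correlation (F : realType) (N : nat) (R : 'M[F]_N) (p : 'cV[F]_N)
    (K : nat) (b a : 'cV[F]_N) : F :=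
  (b^T *m R ^+ K *m diag_mx p^T *m a) 0 0.

Definition delta_correlation (F : realType) (N : nat) (R : 'M[F]_N)
    (p : 'cV[F]_N) (K : nat) (b a : 'cV[F]_N) : F :=
  correlation R p K b a - correlation R p K a b.

(* Pairs with R m n = 0 contribute 0, whatever the value of the logarithm. *)
Definition entropy_production (F : realType) (N : nat) (R : 'M[F]_N)
    (p : 'cV[F]_N) : F :=
  \sum_m \sum_(n | m != n)
    R m n * p n 0 * ln ((R m n * p n 0) / (R n m * p m 0)).

Definition dynamical_activity (F : realType) (N : nat) (R : 'M[F]_N)
    (p : 'cV[F]_N) : F :=
  \sum_m \sum_(n | m != n) R m n * p n 0.

Definition tanh (F : realType) (x : F) : F :=
  (expR x - expR (- x)) / (expR x + expR (- x)).

(* The inverse of the bijection u |-> u * tanh u of [0, +oo[ onto itself,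
   extended by 0 to negative arguments. *)
Definition Phi (F : realType) : F -> F :=
  pinv_ (fun=> 0) `[0, +oo[%classic (fun u => u * tanh u).

(* Main.v *)
Require Import Defs.
From HB Require Import structures.
From mathcomp Require Import all_boot all_order all_algebra.
From mathcomp Require Import complex.
From mathcomp Require Import boolp classical_sets functions.
From mathcomp Require Import reals topology normedtype derive.
From mathcomp Require Import sequences exp.
From mathcomp Require Import ring lra.

Set Implicit Arguments.
Unset Strict Implicit.
Unset Printing Implicit Defensive.

Import Order.TTheory GRing.Theory Num.Theory.
Import numFieldNormedType.Exports.
Local Open Scope ring_scope.

(* With the current J = R Pi - Pi R^T, the difference R^K Pi - Pi (R^T)^K
   telescopes into the sum over j < K of R^(K-1-j) J (R^T)^j. The rows and
   columns of J sum to 0, so the rows b^T R^(K-1-j) and a^T R^j only matter up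
   to additive constants; by the eigenbasis expansion, where v_1 is constant,
   they are within |lambda_2|^(K-1-j) ||b||_* and |lambda_2|^j ||a||_* of
   constants. Hence each summand is at most
   |lambda_2|^(K-1) ||a||_* ||b||_* sum |J_mn|.
   For two opposite flows x and y, put u = |ln (x / y)| / 2: then
   |x - y| = (x + y) tanh u and (x - y) ln (x / y) = 2 (x + y) u tanh u. Since
   tanh u is a concave function of u tanh u, Jensen's inequality gives
   sum |J_mn| <= 2 gamma tanh (Phi (sigma / 2 gamma))
               = sigma / Phi (sigma / 2 gamma). *)

(** * Hyperbolic functions and the function Phi *)

Section Hyperbolic.
Local Open Scope classical_set_scope.
Variable F : realType.
Implicit Types x y d : F.

Definition sinh x : F := (expR x - expR (- x)) / 2.
Definition cosh x : F := (expR x + expR (- x)) / 2.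

Lemma tanhE x : tanh x = sinh x / cosh x.
Proof.
rewrite /tanh /sinh /cosh.
have h : expR x + expR (- x) != 0 by rewrite gt_eqF// addr_gt0 ?expR_gt0.
by field.
Qed.

Lemma cosh_gt0 x : 0 < cosh x.
Proof. by rewrite divr_gt0 ?addr_gt0 ?expR_gt0. Qed.

Lemma sinh0 : sinh 0 = 0 :> F.
Proof. by rewrite /sinh oppr0 subrr mul0r. Qed.

Lemma sinhN x : sinh (- x) = - sinh x.
Proof. by rewrite /sinh opprK -mulNr opprB. Qed.

Lemma coshN x : cosh (- x) = cosh x.
Proof. by rewrite /cosh opprK addrC. Qed.

Lemma sinhD x y : sinh (x + y) = sinh x * cosh y + cosh x * sinh y.
Proof. by rewrite /sinh /cosh opprD !expRD; field. Qed.

Lemma cosh2Bsinh2 x : cosh x ^+ 2 - sinh x ^+ 2 = 1.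
Proof.
have h : expR x * expR (- x) = 1 by rewrite -expRD subrr expR0.
have -> : cosh x ^+ 2 - sinh x ^+ 2 = expR x * expR (- x).
  by rewrite /sinh /cosh; field.
by [].
Qed.

Lemma sinh_ge0 x : 0 <= x -> 0 <= sinh x.
Proof. by move=> x0; rewrite divr_ge0// subr_ge0 ler_expR; lra. Qed.

Lemma is_derive_sinh x : is_derive x 1 sinh (cosh x).
Proof.
rewrite /sinh /cosh; apply: is_derive_eq.
by rewrite /GRing.scale/=; lra.
Qed.

Lemma is_derive_cosh x : is_derive x 1 cosh (sinh x).
Proof.
rewrite /sinh /cosh; apply: is_derive_eq.
by rewrite /GRing.scale/=; lra.
Qed.

Lemma derive_ge0_fun_ge0 (f df : F -> F) :
  (forall x, is_derive x 1 f (df x)) -> f 0 = 0 ->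
  (forall x, 0 <= x -> 0 <= df x) -> forall x, 0 <= x -> 0 <= f x.
Proof.
move=> fdf f0 df0 x x0.
have cf : {within `[0, x]%classic, continuous f}.
  apply: continuous_subspaceT => y; apply: differentiable_continuous.
  by apply/derivable1_diffP; have := fdf y; case.
have [c /[!in_itv]/= /andP[c0 _]] := MVT_segment x0 (fun y _ => fdf y) cf.
by rewrite f0 !subr0 => ->; rewrite mulr_ge0 ?df0.
Qed.

Lemma le_sinh_id x : 0 <= x -> x <= sinh x.
Proof.
rewrite -[x <= _]subr_ge0.
apply: (@derive_ge0_fun_ge0 (fun x => sinh x - x) (fun x => cosh x - 1)).
- by move=> y; have := is_derive_sinh y => ?; apply: is_derive_eq.
- by rewrite sinh0 subrr.
- move=> y _; have c0 := cosh_gt0 y; have := cosh2Bsinh2 y => h.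
  by have := sqr_ge0 (sinh y); nra.
Qed.

Lemma sinh_le_mul_cosh x : 0 <= x -> sinh x <= x * cosh x.
Proof.
rewrite -[_ <= _ * _]subr_ge0.
apply: (@derive_ge0_fun_ge0 (fun x => x * cosh x - sinh x)
  (fun x => x * sinh x)).
- move=> y; have := is_derive_sinh y => ?; have := is_derive_cosh y => ?.
  by apply: is_derive_eq; rewrite /GRing.scale/=; ring.
- by rewrite sinh0 mul0r subrr.
- by move=> y y0; rewrite mulr_ge0 ?sinh_ge0.
Qed.

(** Expanding [sinh (x - u)] turns this into [sinh_tangent]. For [u < x], put [d = x - u], expand
    [sinh x] as [sinh (u + d)] and use [sinh d <= d * cosh d]; for [x <= u] both sides change sign,
    and [u - x <= sinh (u - x)] and [sinh x <= sinh u] suffice. *)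
Lemma mul_sinh_sinhB_le (u x : F) : 0 <= u -> 0 <= x ->
  sinh u * sinh (x - u) <= (x - u) * sinh x.
Proof.
move=> u0 x0; have [ux|/ltW xu] := leP u x.
  have d0 : 0 <= x - u by rewrite subr_ge0.
  have -> : sinh x = sinh u * cosh (x - u) + cosh u * sinh (x - u).
    by rewrite -sinhD addrC subrK.
  have h := ler_wpM2l (sinh_ge0 u0) (sinh_le_mul_cosh d0).
  rewrite mulrDr (le_trans h)// mulrCA lerDl mulr_ge0// mulr_ge0 ?sinh_ge0//.
  exact/ltW/cosh_gt0.
have e0 : 0 <= u - x by rewrite subr_ge0.
rewrite -opprB sinhN mulrN mulNr lerN2.
rewrite [leRHS]mulrC ler_pM ?sinh_ge0 ?le_sinh_id//.
by rewrite /sinh ler_pM2r ?invr_gt0// lerB// ler_expR//; lra.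
Qed.

(* The tangent line at [u tanh u] to the concave function taking [x tanh x] to
   [tanh x], multiplied by [cosh x]. *)
Lemma sinh_tangent (u x : F) : 0 <= u -> 0 <= x ->
  sinh x * (sinh u * cosh u + u) <= x * sinh x + cosh x * sinh u ^+ 2.
Proof.
move=> u0 x0; have := mul_sinh_sinhB_le u0 x0.
by rewrite sinhD sinhN coshN; nra.
Qed.

Lemma continuous_sinh : continuous sinh.
Proof.
move=> y; apply: differentiable_continuous.
by apply/derivable1_diffP; have := is_derive_sinh y; case.
Qed.

Lemma continuous_cosh : continuous cosh.
Proof.
move=> y; apply: differentiable_continuous.
by apply/derivable1_diffP; have := is_derive_cosh y; case.
Qed.

Lemma continuous_mul_tanh : continuous (fun u : F => u * tanh u).
Proof.
under eq_fun do rewrite tanhE.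
move=> y; apply: cvgM; first exact: cvg_id.
apply: cvgM; first exact: continuous_sinh.
by apply: cvgV; [rewrite gt_eqF ?cosh_gt0|exact: continuous_cosh].
Qed.

Lemma ler_tanh x y : x <= y -> tanh x <= tanh y.
Proof.
rewrite -subr_ge0 => /sinh_ge0; rewrite sinhD sinhN coshN => h.
rewrite !tanhE ler_pdivrMr ?cosh_gt0// mulrAC ler_pdivlMr ?cosh_gt0//.
lra.
Qed.

(** Intermediate value theorem on [[0, M]]. Surjectivity makes [Phi] a right inverse, whence
    [Phi_ge0] and [PhiK]. *)
Lemma mul_tanh_surj : set_surj `[0, +oo[%classic `[0, +oo[%classic
  (fun u : F => u * tanh u).
Proof.
move=> s /=; rewrite in_itv/= andbT => s0.
have t1 : 0 < tanh (1 : F).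
  by rewrite tanhE divr_gt0 ?cosh_gt0// (lt_le_trans ltr01)// le_sinh_id.
(* The summand 1 ensures [M >= 1], hence [M * tanh M >= M * tanh 1 >= s]. *)
pose M := s / tanh 1 + 1.
have st0 : 0 <= s / tanh 1 by rewrite divr_ge0 ?(ltW t1).
have M1 : 1 <= M by rewrite /M; lra.
have M0 : 0 <= M by lra.
have sM : s <= M * tanh M.
  rewrite (@le_trans _ _ (M * tanh 1))//.
    by rewrite mulrDl divfK ?gt_eqF//; lra.
  by rewrite ler_wpM2l// ler_tanh.
have [||c] := @IVT F (fun u => u * tanh u) 0 M s M0.
- exact/continuous_subspaceT/continuous_mul_tanh.
- by rewrite mul0r min_l ?max_r ?(le_trans s0)// s0.
rewrite in_itv/= => /andP[c0 _] <-; exists c => //=.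
by rewrite in_itv/= c0.
Qed.

Lemma Phi_ge0 (s : F) : 0 <= s -> 0 <= Phi s.
Proof.
move=> s0; have := surjpinv_image_sub (dflt := fun=> 0 : F) mul_tanh_surj.
move=> /(_ (Phi s)); rewrite /= in_itv/= andbT; apply; exists s => //=.
by rewrite in_itv/= s0.
Qed.

Lemma PhiK (s : F) : 0 <= s -> Phi s * tanh (Phi s) = s.
Proof.
move=> s0; have := @surjpK _ _ (fun=> 0 : F) _ _ _ mul_tanh_surj s.
by rewrite inE/= in_itv/= andbT; exact.
Qed.

(** With [x = c * expR w] and [y = c * expR (- w)], where [c] is the geometric mean of [x] and [y],
    this is [sinh_tangent] at [w] multiplied by [2 * c]. *)
Lemma flow_tangent (u x y : F) : 0 <= u -> 0 < x -> 0 < y ->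
  `|x - y| * (sinh u * cosh u + u) <=
  (x - y) * ln (x / y) / 2 + (x + y) * sinh u ^+ 2.
Proof.
move=> u0; wlog yx : x y / y <= x => [H|] x0 y0.
  have [|/ltW] := leP y x; first by move=> /H; apply.
  move=> /H /(_ y0 x0).
  by rewrite distrC -[y / x]invf_div lnV ?posrE ?divr_gt0// [y + x]addrC; lra.
have r1 : 1 <= x / y by rewrite ler_pdivlMr// mul1r.
pose w := ln (x / y) / 2.
have w0 : 0 <= w by rewrite divr_ge0 ?ln_ge0.
pose c := y * expR w.
have c0 : 0 < c by rewrite mulr_gt0 ?expR_gt0.
have ey : y = c * expR (- w) by rewrite /c -mulrA -expRD subrr expR0 mulr1.
have ex : x = c * expR w.
  rewrite /c -mulrA -expRD -splitr lnK ?posrE ?divr_gt0//.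
  by rewrite mulrCA divff ?mulr1 ?gt_eqF.
have eB : x - y = 2 * c * sinh w by rewrite {1}ex {1}ey /sinh; field.
have eD : x + y = 2 * c * cosh w by rewrite {1}ex {1}ey /cosh; field.
rewrite ger0_norm ?subr_ge0// -[_ * ln _ / 2]mulrA -/w eB eD.
have := sinh_tangent u0 w0; nra.
Qed.

End Hyperbolic.

(** * Flows, entropy production and dynamical activity *)

Lemma sum_offdiag_swap (V : nmodType) (N : nat) (f : 'I_N -> 'I_N -> V) :
  \sum_m \sum_(n | m != n) f n m = \sum_m \sum_(n | m != n) f m n.
Proof.
rewrite (exchange_big_dep predT)//=.
by apply: eq_bigr => m _; apply: eq_bigl => n; rewrite eq_sym.
Qed.

Section Flow.
Variables (F : realType) (N : nat) (w : 'I_N -> 'I_N -> F).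
Hypothesis w_ge0 : forall m n, 0 <= w m n.
Hypothesis w_supp : forall m n, m != n -> 0 < w m n -> 0 < w n m.

Let sigma := \sum_m \sum_(n | m != n) w m n * ln (w m n / w n m).
Let gamma := \sum_m \sum_(n | m != n) w m n.

Lemma flow_cases m n : m != n ->
  (0 < w m n /\ 0 < w n m) \/ (w m n = 0 /\ w n m = 0).
Proof.
move=> mn; have nm : n != m by rewrite eq_sym.
have := w_ge0 m n; rewrite le_eqVlt => /predU1P[h|h].
  right; split=> //; have := w_ge0 n m; rewrite le_eqVlt => /predU1P[//|].
  by move=> /(w_supp nm); rewrite -h ltxx.
by left; split=> //; exact: w_supp.
Qed.

(** Exchanging [m] and [n] flips the sign of the logarithm, so averaging the two forms of [sigma]
    replaces the flow by half the net flow. *)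
Lemma entropy_symE :
  \sum_m \sum_(n | m != n) (w m n - w n m) * ln (w m n / w n m) = 2 * sigma.
Proof.
rewrite mulr2n mulrDl mul1r {2}/sigma.
rewrite -(sum_offdiag_swap (fun m n => w m n * ln (w m n / w n m))).
rewrite -big_split/=; apply: eq_bigr => m _; rewrite -big_split/=.
apply: eq_bigr => n /flow_cases[[mn nm]|[-> ->]]; last first.
  by rewrite !mul0r subrr mul0r addr0.
by rewrite -[w n m / w m n]invf_div lnV ?posrE ?divr_gt0//; ring.
Qed.

Lemma entropy_term_ge0 m n : m != n ->
  0 <= (w m n - w n m) * ln (w m n / w n m).
Proof.
move=> /flow_cases[[mn nm]|[-> ->]]; last by rewrite subrr mul0r.
have [h|/ltW h] := leP (w n m) (w m n).
  by rewrite mulr_ge0 ?subr_ge0// ln_ge0// ler_pdivlMr// mul1r.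
by rewrite mulr_le0 ?subr_le0// ln_le0// ler_pdivrMr// mul1r.
Qed.

Lemma flow_entropy_ge0 : 0 <= sigma.
Proof.
rewrite -(pmulr_rge0 _ (ltr0n F 2)) -entropy_symE.
by do 2!apply: sumr_ge0 => ? ?; exact: entropy_term_ge0.
Qed.

(** All terms of [entropy_symE] are nonnegative, so each one vanishes, and
    [(x - y) * ln (x / y) = 0] with [x, y > 0] forces [x = y]. *)
Lemma entropy0_flow_sym : sigma = 0 -> forall m n, w m n = w n m.
Proof.
move=> s0 m n; have [->//|mn] := eqVneq m n.
have := entropy_symE; rewrite s0 mulr0.
move=> /eqP; rewrite psumr_eq0 => [|k _]; last first.
  by apply: sumr_ge0 => l; exact: entropy_term_ge0.
move=> /allP/(_ m); rewrite mem_index_enum => /(_ isT)/=.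
rewrite psumr_eq0 => [|l]; last exact: entropy_term_ge0.
move=> /allP/(_ n); rewrite mem_index_enum => /(_ isT)/=.
rewrite mn/= mulf_eq0 subr_eq0 => /predU1P[//|].
have [[h1 h2]|[-> ->//]] := flow_cases mn.
rewrite ln_eq0 ?divr_gt0// => /eqP/(congr1 ( *%R^~ (w n m))).
by rewrite divfK ?mul1r ?gt_eqF// => /eqP.
Qed.

(** Jensen's inequality in tangent form: [flow_tangent] is summed over all pairs at the single point
    [u = Phi (sigma / (2 * gamma))]. *)
Lemma sum_abs_flow_le :
  \sum_m \sum_n `|w m n - w n m| <= sigma / Phi (sigma / (2 * gamma)).
Proof.
have [s0|s_neq0] := eqVneq sigma 0.
  rewrite s0 mul0r big1// => m _; rewrite big1// => n _.
  by rewrite (entropy0_flow_sym s0 m n) subrr normr0.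
have s_gt0 : 0 < sigma by rewrite lt0r s_neq0 flow_entropy_ge0.
have g_ge0 : 0 <= gamma by do 2!apply: sumr_ge0 => ? ?.
have g_gt0 : 0 < gamma.
  rewrite lt0r g_ge0 andbT; apply: contra_neq s_neq0 => /eqP.
  rewrite psumr_eq0 => [/allP g0|m _]; last exact: sumr_ge0.
  rewrite /sigma big1// => m _; rewrite big1// => n mn.
  have := g0 m; rewrite mem_index_enum => /(_ isT)/=.
  rewrite psumr_eq0// => /allP/(_ n); rewrite mem_index_enum => /(_ isT).
  by rewrite mn/= => /eqP ->; rewrite mul0r.
set s := sigma / (2 * gamma).
have sg_gt0 : 0 < s by rewrite divr_gt0// mulr_gt0.
set U := Phi s; have U_ge0 : 0 <= U := Phi_ge0 (ltW sg_gt0).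
have UE : U * tanh U = s := PhiK (ltW sg_gt0).
have U_gt0 : 0 < U.
  rewrite lt0r U_ge0 andbT; apply: contraTneq sg_gt0 => U0.
  by rewrite -UE U0 mul0r ltxx.
(* The factor of [|x - y|] in [flow_tangent]; both sides are multiplied by it. *)
set B := sinh U * cosh U + U.
have B_gt0 : 0 < B by rewrite ltr_wpDl// mulr_ge0 ?sinh_ge0// ltW// cosh_gt0.
have offdiag : \sum_m \sum_n `|w m n - w n m| =
    \sum_m \sum_(n | m != n) `|w m n - w n m|.
  apply: eq_bigr => m _; rewrite [LHS](bigD1 m)//= subrr normr0 add0r.
  by apply: eq_bigl => n; rewrite eq_sym.
rewrite offdiag -(ler_pM2r B_gt0).
(* This uses [sigma / U = 2 * gamma * tanh U], the defining property of [U]. *)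
have -> : sigma / U * B = sigma + 2 * gamma * sinh U ^+ 2.
  have sE : sigma = 2 * gamma * (U * tanh U)
    by rewrite UE mulrC divfK// gt_eqF// mulr_gt0.
  have fieldE (x y g u : F) : y != 0 -> u != 0 ->
      2 * g * (u * (x / y)) / u * (x * y + u) =
      2 * g * (u * (x / y)) + 2 * g * x ^+ 2.
    by move=> ? ?; field; apply/andP.
  by rewrite sE tanhE /B fieldE// gt_eqF ?cosh_gt0.
(* Both orders of each pair are summed, so the logarithmic terms give [2 * sigma / 2] and the flows
   give [2 * gamma]. *)
have -> : sigma + 2 * gamma * sinh U ^+ 2 = \sum_m \sum_(n | m != n)
    ((w m n - w n m) * ln (w m n / w n m) / 2 + (w m n + w n m) * sinh U ^+ 2).
  under eq_bigr do rewrite big_split/= -!mulr_suml big_split/=.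
  rewrite big_split/= -!mulr_suml entropy_symE big_split/= (sum_offdiag_swap w).
  by rewrite -/gamma; field.
rewrite mulr_suml ler_sum// => m _; rewrite mulr_suml ler_sum// => n.
move=> /flow_cases[[h1 h2]|[-> ->]]; first exact: flow_tangent.
by rewrite subrr normr0 !mul0r addr0 mul0r addr0.
Qed.

End Flow.

(** * Decay of propagated observables *)

(** Induction on [k]: the difference at [k + 1] is [x] times the difference at [k], plus
    [(x * y - y * z) * z ^+ k]. *)
Lemma telescope_intertwine (A : pzRingType) (x y z : A) (k : nat) :
  x ^+ k * y - y * z ^+ k =
  \sum_(j < k) x ^+ (k.-1 - j) * (x * y - y * z) * z ^+ j.
Proof.
elim: k => [|k IH]; first by rewrite big_ord0 !expr0 mul1r mulr1 subrr.
rewrite big_ord_recr/= subnn expr0 mul1r.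
have -> : \sum_(i < k) x ^+ (k - i) * (x * y - y * z) * z ^+ i =
    x * (x ^+ k * y - y * z ^+ k).
  rewrite IH mulr_sumr; apply: eq_bigr => i _; rewrite !mulrA -exprS.
  by case: k {IH} i => [[]//|k] i; rewrite -subSn ?leq_ord.
by rewrite mulrBr mulrBl !mulrA -!exprS -(mulrA y z) -exprS addrA subrK.
Qed.

Lemma trmx_exp (A : comPzRingType) (N : nat) (M : 'M[A]_N) k :
  (M ^+ k)^T = M^T ^+ k.
Proof.
elim: k => [|k IH]; first by rewrite !expr0 trmx1.
by rewrite exprS exprSr -!mulmxE trmx_mul IH.
Qed.

Lemma bilinear_centered_le (F : realType) (N : nat) (J : 'M[F]_N)
    (x y : 'rV[F]_N) (c d X Y : F) :
  (forall m, \sum_n J m n = 0) -> (forall n, \sum_m J m n = 0) ->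
  (forall k, `|x 0 k - c| <= X) -> (forall k, `|y 0 k - d| <= Y) ->
  `|(x *m J *m y^T) 0 0| <= X * Y * \sum_m \sum_n `|J m n|.
Proof.
move=> Jr Jc xX yY.
have cJ : const_mx c *m J = 0 :> 'rV_N.
  apply/rowP => n; rewrite !mxE; under eq_bigr do rewrite mxE.
  by rewrite -mulr_sumr Jc mulr0.
have Jd : J *m (const_mx d)^T = 0 :> 'cV_N.
  apply/colP => m; rewrite !mxE; under eq_bigr do rewrite !mxE.
  by rewrite -mulr_suml Jr mul0r.
have -> : x *m J *m y^T = (x - const_mx c) *m J *m (y - const_mx d)^T.
  rewrite mulmxBl cJ subr0 raddfB/= mulmxBr -[X in _ = _ - X]mulmxA Jd.
  by rewrite mulmx0 subr0.
rewrite !mxE; under eq_bigr do rewrite !mxE mulr_suml.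
rewrite exchange_big/= (le_trans (ler_norm_sum _ _ _))// mulr_sumr ler_sum//.
move=> m _; rewrite (le_trans (ler_norm_sum _ _ _))// mulr_sumr ler_sum//.
move=> n _.
rewrite !mxE !normrM mulrAC ler_wpM2r//.
by rewrite ler_pM.
Qed.

Section Eigenbasis.
Local Open Scope sesquilinear_scope.
Variables (F : realType) (N : nat) (R : 'M[F]_N).
Implicit Types v : 'cV[F[i]]_N.

Lemma normC_cmod (z : F[i]) : `|z| = (cmod z)%:C%C.
Proof. by rewrite normc_def; case: z. Qed.

Lemma cmodX (z : F[i]) k : cmod (z ^+ k) = cmod z ^+ k.
Proof. by apply: complexI; rewrite rmorphXn/= -!normC_cmod normrX. Qed.

Lemma left_eigenvectorX lam v k : left_eigenvector R lam v ->
  v ^t* *m to_complex R ^+ k = lam ^+ k *: v ^t*.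
Proof.
move=> h; elim: k => [|k IH]; first by rewrite !expr0 mulmx1 scale1r.
by rewrite exprS -mulmxE mulmxA h -scalemxAl IH scalerA exprS.
Qed.

Lemma unit_vector_entry_le1 v k : unit_vector v -> `|v k 0| <= 1.
Proof.
move=> /matrixP/(_ 0 0); rewrite !mxE eqxx mulr1n => h.
rewrite -(@expr_le1 _ 2)//.
have -> : 1 = \sum_j `|v j 0| ^+ 2.
  by rewrite -h; apply: eq_bigr => j _; rewrite !mxE normCKC.
by rewrite (bigD1 k)//= lerDl sumr_ge0// => j _; rewrite exprn_ge0.
Qed.

End Eigenbasis.

(** In the left eigenbasis, [R ^+ j] multiplies the [n]-th component by [lambda n ^+ j]. The
    component of index 0 is a constant row; the others have entries of modulus at most [r ^+ j]
    times their coefficient, since unit vectors have entries of modulus at most 1. *)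
Lemma propagated_observable_le (F : realType) (N : nat) (R : 'M[F]_N)
    (lambda : 'I_N -> F[i]) (v : 'I_N -> 'cV[F[i]]_N) (r : F) (b : 'cV[F]_N)
    (j : nat) :
  left_eigenbasis R lambda v ->
  (forall n : 'I_N, (0 < n)%N -> cmod (lambda n) <= r) ->
  exists c : F, forall k,
    `|(b^T *m R ^+ j) 0 k - c| <= r ^+ j * star_norm v (to_complex b).
Proof.
case: N R lambda v b => [|N] R lambda v b [vB eigv unitv v0] lam_le.
  by exists 0 => -[].
have [c v0E] := v0 ord0 erefl.
pose beta n := coord (mktuple v) n (to_complex b).
have bE : to_complex b = \sum_n beta n *: v n.
  rewrite {1}(coord_basis vB (memvf (to_complex b))).
  by apply: eq_bigr => n _; rewrite nth_mktuple.
(* Coefficients of the row [b^T *m R ^+ j] on the adjoints of the [v n]; the conjugate appears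
   because the real [b^T] is read as the adjoint of [b]. *)
pose t n := (beta n)^* * lambda n ^+ j.
have bRE k : ((b^T *m R ^+ j) 0 k)%:C%C = \sum_n t n * (v n k 0)^*.
  have -> : ((b^T *m R ^+ j) 0 k)%:C%C =
      ((to_complex b) ^t* *m to_complex R ^+ j)%sesqui 0 k.
    rewrite /to_complex -rmorphXn/= !mxE raddf_sum/=.
    apply: eq_bigr => l _; rewrite !mxE rmorphM/=; congr (_ * _).
    by apply/esym/CrealP; apply/complex_realP; exists (b l 0).
  rewrite bE !raddf_sum/= mulmx_suml summxE.
  apply: eq_bigr => n _; rewrite linearZ/= map_mxZ -scalemxAl.
  by rewrite (left_eigenvectorX _ (eigv n)) scalerA !mxE.
(* The row is real, so taking the real part of the complex constant does not increase the
   distance. *)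
exists (complex.Re (t ord0 * c^*)) => k.
suff : (`|(b^T *m R ^+ j) 0 k - complex.Re (t ord0 * c^*)|%:C <=
    (r ^+ j * star_norm v (to_complex b))%:C)%C by rewrite lecR.
set z := t ord0 * c^*.
have -> : (b^T *m R ^+ j) 0 k - complex.Re z =
    complex.Re (((b^T *m R ^+ j) 0 k)%:C%C - z).
  by case: z.
rewrite (le_trans (normc_ge_Re _))// bRE (bigD1 ord0)//= v0E !mxE mulr1.
rewrite addrAC subrr add0r (le_trans (ler_norm_sum _ _ _))//.
rewrite /star_norm rmorphM raddf_sum/= mulr_sumr.
have -> : (\sum_(n < N.+1 | (0 < n)%N) (r ^+ j)%:C%C *
    (cmod (coord (mktuple v) n (to_complex b)))%:C%C =
    \sum_(n < N.+1 | n != ord0) (r ^+ j)%:C%C * `|beta n|).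
  by apply: eq_big => n; rewrite ?lt0n// => _; rewrite normC_cmod.
apply: ler_sum => n n0; rewrite !normrM !norm_conjC.
rewrite -[leRHS]mulr1 ler_pM ?mulr_ge0 ?unit_vector_entry_le1//.
rewrite mulrC ler_wpM2r// normC_cmod lecR cmodX.
have ln := lam_le n; rewrite lt0n in ln; rewrite lerXn2r ?nnegrE ?ln//.
  by case: (lambda n) => ? ?; exact: sqrtr_ge0.
by apply: le_trans (ln n0); case: (lambda n) => ? ?; exact: sqrtr_ge0.
Qed.

(** * Stationary currents and correlations *)

(** Some state has positive mass, and a power of [R], which fixes [p], carries part of it to any
    given state. Positivity transfers the symmetric support of [R] to the flows. *)
Lemma steady_state_gt0 (F : realType) (N : nat) (R : 'M[F]_N) (p : 'cV[F]_N) :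
  stochastic R -> irreducible_chain R -> steady_state R p ->
  forall n, 0 < p n 0.
Proof.
move=> [R_ge0 _] R_irr [[p_ge0 p_sum] Rp] m.
have Rkp k : R ^+ k *m p = p.
  by elim: k => [|k IH]; rewrite ?mul1mx// exprSr -mulmxA Rp IH.
have Rk_ge0 k i j : 0 <= (R ^+ k) i j.
  elim: k i j => [|k IH] i j; first by rewrite expr0 mxE ler0n.
  by rewrite exprS mxE sumr_ge0// => l _; rewrite mulr_ge0.
have [n pn_gt0] : exists n, 0 < p n 0.
  apply: contrapT => p0; move: p_sum; rewrite big1.
    by move=> /esym/eqP; rewrite oner_eq0.
  move=> n _; apply/eqP; rewrite eq_le p_ge0 andbT leNgt.
  by apply/negP => ?; apply: p0; exists n.
have [k Rk_gt0] := R_irr m n.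
rewrite -(Rkp k) mxE (bigD1 n)//= ltr_wpDr ?mulr_gt0//.
by rewrite sumr_ge0// => j _; rewrite mulr_ge0.
Qed.

(** The defect from detailed balance, in the form [x * y - y * z] required by
    [telescope_intertwine]. *)
Definition probability_current (F : realType) (N : nat) (R : 'M[F]_N)
    (p : 'cV[F]_N) : 'M[F]_N :=
  R *m diag_mx p^T - diag_mx p^T *m R^T.

Section ProbabilityCurrent.
Variables (F : realType) (N : nat) (R : 'M[F]_N) (p : 'cV[F]_N).
Let J := probability_current R p.

Lemma probability_currentE m n : J m n = R m n * p n 0 - R n m * p m 0.
Proof.
rewrite /J /probability_current mul_mx_diag mul_diag_mx !mxE.
by rewrite (mulrC (p m 0)).
Qed.

Lemma sum_probability_current :
  stochastic R -> steady_state R p ->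
  (forall m, \sum_n J m n = 0) /\ (forall n, \sum_m J m n = 0).
Proof.
move=> [_ R1] [_ Rp].
have pE m : \sum_n R m n * p n 0 = p m 0 by rewrite -[in RHS]Rp mxE.
split=> m; under eq_bigr do rewrite probability_currentE.
  by rewrite sumrB pE -mulr_suml R1 mul1r subrr.
by rewrite sumrB pE -mulr_suml R1 mul1r subrr.
Qed.

Lemma delta_correlationE K (a b : 'cV[F]_N) :
  delta_correlation R p K b a =
  \sum_(j < K) (b^T *m R ^+ (K.-1 - j) *m J *m (a^T *m R ^+ j)^T) 0 0.
Proof.
have -> : delta_correlation R p K b a =
    (b^T *m (R ^+ K *m diag_mx p^T - diag_mx p^T *m R^T ^+ K) *m a) 0 0.
  have entryB (X Y : 'M[F]_1) : (X - Y) 0 0 = X 0 0 - Y 0 0 by rewrite !mxE.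
  rewrite mulmxBr mulmxBl entryB /delta_correlation /correlation.
  congr (_ - _); first by rewrite !mulmxA.
  (* A 1 by 1 matrix equals its transpose, which moves [a] to the right and [b] to the left. *)
  transitivity ((a^T *m R ^+ K *m diag_mx p^T *m b)^T 0 0).
    by rewrite [RHS]mxE.
  by rewrite !trmx_mul trmxK tr_diag_mx trmx_exp !mulmxA.
rewrite (telescope_intertwine R (diag_mx p^T) R^T K).
rewrite mulmx_sumr mulmx_suml summxE; apply: eq_bigr => j _.
by rewrite trmx_mul trmxK trmx_exp !mulmxA.
Qed.

End ProbabilityCurrent.

(* hN : 1 < N makes Ordinal hN the index of lambda_2. For sigma = 0 the quotient
   sigma / Phi _ is 0, whatever its denominator. *)
Theorem mainTheorem5 (F : realType) (N : nat) (hN : (1 < N)%N)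
    (R : 'M[F]_N) (p : 'cV[F]_N)
    (lambda : 'I_N -> F[i]) (v : 'I_N -> 'cV[F[i]]_N)
    (K : nat) (a b : 'cV[F]_N)
    (R_stochastic : stochastic R)
    (R_irreducible : irreducible_chain R)
    (R_support : forall m n, m != n -> 0 < R m n <-> 0 < R n m)
    (p_steady : steady_state R p)
    (v_basis : left_eigenbasis R lambda v)
    (lambda1 : lambda (Ordinal (ltnW hN)) = 1)
    (lambda2_lt1 : cmod (lambda (Ordinal hN)) < 1)
    (lambda_decr : forall m n : 'I_N, (0 < m)%N -> (m <= n)%N ->
       cmod (lambda n) <= cmod (lambda m))
    (lambda2_neq0 : lambda (Ordinal hN) <> 0)
    (K_gt0 : (0 < K)%N)
    (ab_neq0 : star_norm v (to_complex a) * star_norm v (to_complex b) <> 0) :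
  let g := spectral_gap (lambda (Ordinal hN)) in
  let sigma := entropy_production R p in
  let gamma := dynamical_activity R p in
  `|delta_correlation R p K b a|
    / (star_norm v (to_complex a) * star_norm v (to_complex b))
  <= K%:R * expR (- (K%:R - 1) * g) * (sigma / Phi (sigma / (2 * gamma))).
Proof.
cbv zeta; set g := spectral_gap _; set sigma := entropy_production R p.
set gamma := dynamical_activity R p.
set r := cmod (lambda (Ordinal hN)).
set A := star_norm v (to_complex a); set B := star_norm v (to_complex b).
have cmod_ge0 (z : F[i]) : 0 <= cmod z by case: z => ? ?; exact: sqrtr_ge0.
have star_ge0 z : 0 <= star_norm v z by apply: sumr_ge0.
have AB_gt0 : 0 < A * B.
  by rewrite lt0r mulr_ge0 ?star_ge0// andbT; apply/eqP.
have r_gt0 : 0 < r.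
  rewrite lt0r cmod_ge0 andbT; apply/eqP => /Normc.eq0_normc.
  exact: lambda2_neq0.
have lam_le (n : 'I_N) : (0 < n)%N -> cmod (lambda n) <= r.
  exact: (lambda_decr (Ordinal hN)).
have rate : expR (- (K%:R - 1) * g) = r ^+ K.-1.
  rewrite /g /spectral_gap mulrNN -(prednK K_gt0) -natr1 addrK.
  by rewrite mulrC expRM_natr lnK.
pose w m n := R m n * p n 0.
have p_gt0 := steady_state_gt0 R_stochastic R_irreducible p_steady.
have w_ge0 m n : 0 <= w m n.
  by rewrite mulr_ge0 ?(ltW (p_gt0 _))//; case: R_stochastic.
have w_supp m n : m != n -> 0 < w m n -> 0 < w n m.
  by move=> mn; rewrite !pmulr_lgt0//; have [] := R_support m n mn.
have flow_le := sum_abs_flow_le w_ge0 w_supp.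
rewrite rate ler_pdivrMr// delta_correlationE.
have [Jr Jc] := sum_probability_current R_stochastic p_steady.
set S := \sum_m \sum_n `|w m n - w n m| in flow_le.
have -> : K%:R * r ^+ K.-1 * (sigma / Phi (sigma / (2 * gamma))) * (A * B) =
    \sum_(j < K) r ^+ K.-1 * (A * B) * (sigma / Phi (sigma / (2 * gamma))).
  by rewrite sumr_const card_ord -[RHS]mulr_natl; ring.
rewrite (le_trans (ler_norm_sum _ _ _))// ler_sum// => j _.
have [c bc] := propagated_observable_le b (K.-1 - j) v_basis lam_le.
have [d ad] := propagated_observable_le a j v_basis lam_le.
apply: (le_trans (bilinear_centered_le Jr Jc bc ad)).
(* The two decay rates combine to a bound independent of [j], so the [K] summands give the factor
   [K]. *)
have -> : r ^+ (K.-1 - j) * B * (r ^+ j * A) = r ^+ K.-1 * (A * B).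
  rewrite mulrACA -exprD subnK ?(mulrC B)//.
  by rewrite -ltnS prednK.
rewrite ler_wpM2l//; first by rewrite mulr_ge0 ?exprn_ge0// ltW.
rewrite (le_trans _ flow_le)// /S.
by under eq_bigr do under eq_bigr do rewrite probability_currentE.
Qed.
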